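(* Let $p_1,\dots,p_n$ be the radii polynomials, $p_j(r)=(Y+Z(r))_j-r$, where $Y$ and $Z(r)$ are vectors satisfying (componentwise) $$|T(\bar x)-\bar x|\le Y,\qquad \sup_{b,c\in B(r)}|DT(\bar x+b)c|\le Z(r).$$ Then for any $r>0$ such that $$p_j(r)<0\quad\text{for all } j=1,\dots,n,$$ there exists a unique $x\in B_{\bar x}(r)$ such that $f(x)=0$.
   Context: Let $A\in\mathbb{C}^{n\times n}$ and let $(\bar\lambda,\bar{\mathrm v})\in\mathbb{C}\times\mathbb{C}^n$ be an approximate eigenpair of $A$ (i.e. $A\bar{\mathrm v}\approx\bar\lambda\bar{\mathrm v}$; no quantitative closeness is prescribed). Let $k$ be an index for which $\bar{\mathrm v}_k$ is a component of $\bar{\mathrm v}$ of largest modulus. Points of $\mathbb{C}^n$ are written $x=(\lambda,\mathrm v_1,\dots,\mathrm v_{k-1},\mathrm v_{k+1},\dots,\mathrm v_n)$, and $f:\mathbb{C}^n\to\mathbb{C}^n$ is defined by $$f(x)=A\mathrm w-\lambda\mathrm w,\qquad \mathrm w=(\mathrm v_1,\dots,\mathrm v_{k-1},\bar{\mathrm v}_k,\mathrm v_{k+1},\dots,\mathrm v_n)^{T},$$ where $\bar{\mathrm v}_k$ is a fixed parameter. Put $\bar x=(\bar\lambda,\bar{\mathrm v}_1,\dots,\bar{\mathrm v}_{k-1},\bar{\mathrm v}_{k+1},\dots,\bar{\mathrm v}_n)$. Let $R\in\mathbb{C}^{n\times n}$ be a fixed matrix which is a numerical inverse of the Jacobian $Df(\bar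 x)$ (i.e. $R\,Df(\bar x)\approx I_n$; no quantitative closeness is prescribed). $\Omega$ is the Banach space $\mathbb{C}^n$ with norm $\|x\|_\Omega=\max_i|x_i|$. The operator $T:\Omega\to\Omega$ is $T(x)=x-Rf(x)$, with Jacobian $DT(x)=I_n-R\,Df(x)$. $B(r)=\{x\in\Omega:\|x\|_\Omega\le r\}$ and $B_{\bar x}(r)=\bar x+B(r)$. For a vector or matrix, $|\cdot|$ is the componentwise complex absolute value, and inequalities and suprema of real vectors are componentwise (so $Y$ and $Z(r)$ have real nonnegative entries). The vector $Y\in\Omega$ is independent of $r$, while $Z(r)\in\Omega$ depends on $r>0$ and satisfies its bound for each $r$ considered. *)

(* Defs.v *)
From HB Require Import structures.
From mathcomp Require Import all_boot all_order all_algebra.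
From mathcomp Require Import complex.
From mathcomp Require Import all_classical all_reals all_analysis.

Set Implicit Arguments.
Unset Strict Implicit.
Unset Printing Implicit Defensive.

Import Order.TTheory GRing.Theory Num.Theory.
Import numFieldNormedType.Exports.

Local Open Scope classical_set_scope.
Local Open Scope complex_scope.
Local Open Scope ring_scope.

Section RadiiPolynomials.
Variables (R : realType) (n : nat).

(* The dimension of the eigenvalue problem is n.+1, as it must be positive for
   the index k to exist.  The norm `|x| on 'cV[R[i]]_n.+1 is the library's norm
   on matrices, max_i |x_i|. *)
Local Notation C := R[i].
Local Notation Omega := 'cV[R[i]]_n.+1.

(* The eigenvector w encoded by x = (lambda, v_1, .., v_(k-1), v_(k+1), .., v_n),
   whose k-th component is frozen to vk; the other components of w are, in
   order, the components of x after the first. *)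
Definition eigvec (k : 'I_n.+1) (vk : C) (x : Omega) : Omega :=
  \col_i (if unlift k i is Some j then x (lift ord0 j) 0 else vk).

Definition eigmap (A : 'M[C]_n.+1) (k : 'I_n.+1) (vk : C) (x : Omega) : Omega :=
  A *m eigvec k vk x - x ord0 0 *: eigvec k vk x.

Definition eigpoint (k : 'I_n.+1) (lambda : C) (v : Omega) : Omega :=
  \col_i (if unlift ord0 i is Some j then v (lift k j) 0 else lambda).

Definition newton_map (S : 'M[C]_n.+1) (f : Omega -> Omega) (x : Omega) : Omega :=
  x - S *m f x.

(* The Jacobian matrix of complex partial derivatives, acting on columns (the
   library's [jacobian] is its transpose, for maps between row vectors).  In
   [^o], the complex field is a normed module over itself. *)
Definition cjacobian (F : Omega -> Omega) (x : Omega) : 'M[C]_n.+1 :=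
  \matrix_(i, j) 'D_(delta_mx j 0) (fun y : Omega => F y i 0 : C^o) x.

Definition Bball (x : Omega) (r : R) : set Omega :=
  closed_ball_ Num.norm x r%:C.

Definition cabs (z : C) : R := Normc.normc z.

(* The supremum is taken in the extended reals, so that it is not a dummy value
   when the set is unbounded. *)
Definition sup_DT (T : Omega -> Omega) (x : Omega) (r : R) (j : 'I_n.+1) :
    \bar R :=
  ereal_sup [set (cabs ((cjacobian T (x + bc.1) *m bc.2) j 0))%:E |
             bc in Bball 0 r `*` Bball 0 r].

Definition radii_poly (Y : 'cV[R]_n.+1) (Z : R -> 'cV[R]_n.+1) (j : 'I_n.+1)
    (r : R) : R :=
  (Y + Z r) j 0 - r.

End RadiiPolynomials.

(* Main.v *)
(* Componentwise, |DT(xbar + b) c| <= Z(r) < r for b, c in B(r), so all the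
   matrices DT(x) with x in the ball contract the max norm by a common factor
   q < 1.  As f is quadratic, T y - T x = DT((x + y) / 2) (y - x) exactly; hence
   T is a q-contraction of the ball, and maps it into itself because
   Y + Z(r) < r.  Banach's theorem gives a unique fixed point of T, which is a
   zero of f because R is invertible: I - R Df(xbar) = DT(xbar) is a
   contraction, so R Df(xbar) is invertible.  (The paper's matrix R is S here.) *)

Require Import Defs.
From mathcomp Require Import all_boot all_order all_algebra.
From mathcomp Require Import complex.
From mathcomp Require Import all_classical all_reals all_analysis.
From mathcomp Require Import ring lra.

Set Implicit Arguments.
Unset Strict Implicit.
Unset Printing Implicit Defensive.

Import Order.TTheory GRing.Theory Num.Theory.
Import numFieldNormedType.Exports.

Local Open Scope classical_set_scope.
Local Open Scope complex_scope.
Local Open Scope ring_scope.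

(** * Sequences with geometrically decaying increments *)

(* The limit is the supremum of the nondecreasing sequence u m - K * q ^+ m. *)
Lemma geometric_increments_cvg (R : realType) (u : nat -> R) (K q : R) :
  0 <= q -> q < 1 -> 0 <= K ->
  (forall m, `|u m.+1 - u m| <= K * (1 - q) * q ^+ m) ->
  exists l, forall m, `|u m - l| <= K * q ^+ m.
Proof.
move=> q0 q1 K0 du.
(* Since K q^m - K q^(m+1) = K (1 - q) q^m is exactly the allowed increment, the intervals [[a m],
   [b m]] are nested. *)
pose a m := u m - K * q ^+ m; pose b m := u m + K * q ^+ m.
have aS m : a m <= a m.+1.
  have := du m; rewrite ler_norml => /andP[+ _].
  by rewrite /a exprS; lra.
have bS m : b m.+1 <= b m.
  have := du m; rewrite ler_norml => /andP[_].
  by rewrite /b exprS; lra.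
have ndeca : {homo a : m p / (m <= p)%N >-> m <= p}.
  by apply: homo_leq => // x y z; exact: le_trans.
have nincb : {homo b : m p / (m <= p)%N >-> p <= m}.
  by apply: homo_leq => // x y z xy yz; exact: le_trans yz xy.
have ab m p : a m <= b p.
  have [mp|/ltnW pm] := leqP m p.
    apply: le_trans (ndeca _ _ mp) _.
    by have := mulr_ge0 K0 (exprn_ge0 p q0); rewrite /a /b; lra.
  apply: le_trans (nincb _ _ pm).
  by have := mulr_ge0 K0 (exprn_ge0 m q0); rewrite /a /b; lra.
exists (sup (range a)) => m.
have al : a m <= sup (range a).
  by apply: ub_le_sup; [exists (b 0%N) => _ [p _ <-] | exists m].
have lb : sup (range a) <= b m.
  by apply: ge_sup; [exists (a 0%N), 0%N | move=> _ [p _ <-]].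
by move: al lb; rewrite /a /b ler_norml; lra.
Qed.

(** * The complex modulus *)

Lemma normcE (R : realType) (z : R[i]) : `|z| = (cabs z)%:C.
Proof. by case: z. Qed.

Lemma cabsD (R : realType) (y z : R[i]) : cabs (y + z) <= cabs y + cabs z.
Proof. exact: le_normcD. Qed.

Lemma cabs_ge0 (R : realType) (z : R[i]) : 0 <= cabs z.
Proof. by rewrite -lecR -normcE normr_ge0. Qed.

Lemma cabsN (R : realType) (z : R[i]) : cabs (- z) = cabs z.
Proof. exact: normcN. Qed.

Lemma cabs_nat (R : realType) (m : nat) : cabs (m%:R : R[i]) = m%:R.
Proof. by apply: complexI; rewrite -normcE normr_nat rmorph_nat. Qed.

Lemma Re_le_cabs (R : realType) (z : R[i]) : `|complex.Re z| <= cabs z.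
Proof. by rewrite -lecR -normcE normc_ge_Re. Qed.

Lemma Im_le_cabs (R : realType) (z : R[i]) : `|complex.Im z| <= cabs z.
Proof.
case: z => a b /=; rewrite /cabs /= -sqrtr_sqr ler_wsqrtr// lerDr.
exact: sqr_ge0.
Qed.

Lemma cabs_le_ReIm (R : realType) (z : R[i]) :
  cabs z <= `|complex.Re z| + `|complex.Im z|.
Proof.
case: z => a b; rewrite /cabs /= -[leRHS]ger0_norm ?addr_ge0//.
rewrite -sqrtr_sqr ler_wsqrtr// sqrrD !real_normK ?num_real//.
by rewrite -addrA lerD2l lerDr mulrn_wge0// mulr_ge0.
Qed.

(** * The max norm on complex columns and the contraction principle *)

Section Cnorm.
Variables (R : realType) (n : nat).
Implicit Types x y : 'cV[R[i]]_n.+1.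

(* The library norm of a complex matrix takes its values in R[i]. *)
Definition cnorm x : R := complex.Re `|x|.

Lemma cnormE x : `|x| = (cnorm x)%:C.
Proof. by rewrite /cnorm; apply/esym/eqP; rewrite RRe_real ?normr_real. Qed.

Lemma cnorm_ge0 x : 0 <= cnorm x.
Proof. by rewrite -lecR -cnormE; exact: normr_ge0. Qed.

Lemma cnormP x (a : R) : 0 <= a ->
  cnorm x <= a <-> forall j, cabs (x j 0) <= a.
Proof.
move=> a0; have a0C : 0 <= a%:C by rewrite lecR.
rewrite -lecR -cnormE /Num.norm/= mx_normE; split.
  move=> xa j; rewrite -lecR -normcE; apply: le_trans xa.
  by rewrite -[leLHS]nngE num_le (le_bigmax _ _ (j, 0)).
move=> xa; rewrite -[leRHS]/((NngNum a0C)%:num) num_le; apply/bigmax_leP.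
split=> [|[i j] _]; first by rewrite -num_le.
by rewrite -num_le/= ord1 normcE lecR.
Qed.

Lemma cnormD x y : cnorm (x + y) <= cnorm x + cnorm y.
Proof. by rewrite -lecR rmorphD/= -!cnormE; exact: ler_normD. Qed.

Lemma cnormN x : cnorm (- x) = cnorm x.
Proof. by rewrite /cnorm normrN. Qed.

Lemma cnormB x y : cnorm (x - y) = cnorm (y - x).
Proof. by rewrite -cnormN opprB. Qed.

Lemma cnormZ (t : R[i]) x : cnorm (t *: x) = cabs t * cnorm x.
Proof.
by apply/eqP; rewrite -(inj_eq (@complexI R)) rmorphM/= -normcE -!cnormE normrZ.
Qed.

Lemma cnorm_half x : cnorm (2^-1 *: x) = 2^-1 * cnorm x.
Proof.
by rewrite cnormZ [cabs _]Normc.normcV -[Normc.normc 2]/(cabs 2%:R) cabs_nat.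
Qed.

Lemma cnorm0_eq0 x : cnorm x = 0 -> x = 0.
Proof. by move=> x0; apply/normr0_eq0; rewrite cnormE x0. Qed.

Lemma cnorm_le_triangle y x z : cnorm (x - z) <= cnorm (x - y) + cnorm (y - z).
Proof.
by have -> : x - z = (x - y) + (y - z) by [rewrite addrA subrK]; exact: cnormD.
Qed.

Lemma BballE (r : R) x y : Bball x r y <-> cnorm (x - y) <= r.
Proof. by rewrite /Bball /closed_ball_/= cnormE lecR. Qed.

(** Real and imaginary parts of each component converge separately; adding their two errors gives
    the factor 2. *)
Lemma geometric_increments_cvg_cV (u : nat -> 'cV[R[i]]_n.+1) (K q : R) :
  0 <= q -> q < 1 -> 0 <= K ->
  (forall m, cnorm (u m.+1 - u m) <= K * (1 - q) * q ^+ m) ->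
  exists l, forall m, cnorm (u m - l) <= (2 * K) * q ^+ m.
Proof.
move=> q0 q1 K0 du.
have Kq m : 0 <= K * (1 - q) * q ^+ m.
  by rewrite mulr_ge0 ?mulr_ge0 ?exprn_ge0// subr_ge0 ltW.
have duj j m : cabs (u m.+1 j 0 - u m j 0) <= K * (1 - q) * q ^+ m.
  by have /(cnormP _ (Kq m))/(_ j) := du m; rewrite !mxE.
have /choice[lr ulr] : forall j, exists l : R, forall m,
    `|complex.Re (u m j 0) - l| <= K * q ^+ m.
  move=> j; apply: geometric_increments_cvg => // m.
  by rewrite -raddfB/= (le_trans (Re_le_cabs _)).
have /choice[li uli] : forall j, exists l : R, forall m,
    `|complex.Im (u m j 0) - l| <= K * q ^+ m.
  move=> j; apply: geometric_increments_cvg => // m.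
  by rewrite -raddfB/= (le_trans (Im_le_cabs _)).
exists (\col_j (lr j +i* li j)) => m.
apply/cnormP; first by rewrite mulr_ge0 ?mulr_ge0 ?exprn_ge0.
move=> j; rewrite !mxE (le_trans (cabs_le_ReIm _))// !raddfB/=.
by rewrite -mulrA [leRHS]mulrDl mul1r lerD.
Qed.

(** Turns inequalities valid up to a geometric error along the iterates into inequalities for their
    limit. *)
Lemma exp_bound_le0 (a K q : R) :
  0 <= q -> q < 1 -> (forall m, a <= K * q ^+ m) -> a <= 0.
Proof.
move=> q0 q1 aK.
have : K * q ^+ m @[m --> \oo] --> (0 : R).
  by apply: cvg_geometric; rewrite ger0_norm.
by move=> Kq; apply: (ler_cvg_to (cvg_cst a) Kq); apply: nearW.
Qed.

(* Proved by hand: the library's [banach_fixed_point] needs a complete normed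
   module over a realType, while 'cV[R[i]] is one over R[i]. *)
Lemma banach_fixed_point_cV (T : 'cV[R[i]]_n.+1 -> 'cV[R[i]]_n.+1) x0 (r q : R) :
  0 <= q -> q < 1 -> 0 <= r ->
  (forall x, cnorm (x0 - x) <= r -> cnorm (x0 - T x) <= r) ->
  (forall x y, cnorm (x0 - x) <= r -> cnorm (x0 - y) <= r ->
    cnorm (T x - T y) <= q * cnorm (x - y)) ->
  exists x, cnorm (x0 - x) <= r /\ T x = x.
Proof.
move=> q0 q1 r0 Tball Tq.
pose u m := iter m T x0.
have ur m : cnorm (x0 - u m) <= r.
  elim: m => [|m IH]; last by apply: Tball.
  by rewrite /u/= subrr /cnorm normr0.
(* Chosen so that [K * (1 - q)] is the length of the first increment. *)
pose K := cnorm (u 1%N - u 0%N) / (1 - q).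
have q1' : 1 - q != 0 by rewrite gt_eqF// subr_gt0.
have K0 : 0 <= K by rewrite divr_ge0 ?cnorm_ge0// subr_ge0 ltW.
have [l ul] : exists l, forall m, cnorm (u m - l) <= 2 * K * q ^+ m.
  apply: geometric_increments_cvg_cV => // m; rewrite divfK//.
  elim: m => [|m IH]; first by rewrite expr0 mulr1.
  rewrite exprS mulrCA; apply: le_trans (ler_wpM2l q0 IH).
  exact: (Tq (u m.+1) (u m) (ur _) (ur _)).
have lr : cnorm (x0 - l) <= r.
  rewrite -subr_le0; apply: (exp_bound_le0 (K := 2 * K) q0 q1) => m.
  by have := cnorm_le_triangle (u m) x0 l; have := ur m; have := ul m; lra.
exists l; split=> //; apply/eqP; rewrite -subr_eq0; apply/eqP/cnorm0_eq0.
apply/eqP; rewrite eq_le cnorm_ge0 andbT.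
(* The distance from [T l] to [l] is at most that from [T l] to [u m.+1] plus that from [u m.+1] to
   [l]; each is at most 2 K q^m. *)
apply: (exp_bound_le0 (K := 4 * K) q0 q1) => m.
have := cnorm_le_triangle (u m.+1) (T l) l.
have := Tq _ _ lr (ur m); rewrite -/(u m.+1) (cnormB l).
have := ler_wpM2l q0 (ul m); have := ul m.+1; rewrite exprS -[T (u m)]/(u m.+1).
have : 2 * K * (q * q ^+ m) <= 2 * K * q ^+ m.
  apply: ler_wpM2l; first by rewrite mulr_ge0.
  by rewrite ler_piMl ?exprn_ge0// ltW.
by rewrite mulrCA; lra.
Qed.
End Cnorm.

(** * Derivatives and exact expansions of the eigenvalue and Newton maps *)

(** For nonzero [h] the difference quotient is exactly [a + h * b]. *)
Lemma derive_quadratic (K : numFieldType) (V : normedModType K) (g : V -> K^o)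
    (x v : V) (a b : K) :
  (forall h : K, g (h *: v + x) = g x + h * a + h ^+ 2 * b) -> 'D_v g x = a.
Proof.
move=> gE; apply: cvg_lim; first exact: norm_hausdorff.
have : (fun h : K => a + h * b : K^o) @ 0^' --> (a + 0 * b : K^o).
  apply: (cvg_trans (cvg_app _ (@nbhs_dnbhs _ (0 : K)))).
  apply: cvgD; first exact: cvg_cst.
  by apply: cvgMl; exact: cvg_id.
rewrite mul0r addr0; apply: cvg_trans; apply: near_eq_cvg.
near=> h.
have h0 : h != 0 by near: h; exact: nbhs_dnbhs_neq.
rewrite /= gE (_ : _ - g x = h * (a + h * b)); first exact/esym/mulKf.
rewrite -[_ + _ + _ - _]/((g x : K) + h * a + h ^+ 2 * b - g x); ring.
Unshelve. all: by end_near. Qed.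

Section Eigmap.
Variables (R : realType) (n : nat).
Variables (A S : 'M[R[i]]_n.+1) (k : 'I_n.+1) (vk : R[i]).
Local Notation C := R[i].
Local Notation Omega := 'cV[C]_n.+1.

(* The linear part of the affine map [eigvec k vk]. *)
Definition eigdir : 'M[C]_n.+1 :=
  \matrix_(i, l) if unlift k i is Some j then (l == lift ord0 j)%:R else 0.

(** Product rule: the last term, a column times a coordinate row, comes from differentiating the
    eigenvalue in [lambda *: w]. *)
Definition Deigmap (x : Omega) : 'M[C]_n.+1 :=
  A *m eigdir - x ord0 0 *: eigdir - eigvec k vk x *m delta_mx 0 ord0.

Definition Dnewton (x : Omega) : 'M[C]_n.+1 := 1%:M - S *m Deigmap x.

Lemma eigvecD (x h : Omega) : eigvec k vk (x + h) = eigvec k vk x + eigdir *m h.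
Proof.
apply/colP => i; rewrite !mxE; under eq_bigr do rewrite mxE.
case: unliftP => [j _|_]; last first.
  by rewrite big1 ?addr0// => l _; rewrite mul0r.
rewrite mxE (bigD1 (lift ord0 j))//= eqxx mul1r big1 ?addr0// => l /negPf->.
by rewrite mul0r.
Qed.

Lemma mulmx_Deigmap (x h : Omega) : Deigmap x *m h =
  A *m (eigdir *m h) - x ord0 0 *: (eigdir *m h) - h ord0 0 *: eigvec k vk x.
Proof.
rewrite /Deigmap !mulmxBl -scalemxAl -!mulmxA -rowE -[h _ _ *: _]mul_mx_scalar.
congr (_ - _ *m _).
by apply/matrixP => i j; rewrite !mxE !ord1 mulr1n.
Qed.

(** The only nonlinearity is the product of eigenvalue and eigenvector, so the expansion stops at
    order two. *)
Lemma eigmapD (x h : Omega) :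
  eigmap A k vk (x + h) =
  eigmap A k vk x + Deigmap x *m h - h ord0 0 *: (eigdir *m h).
Proof.
rewrite /eigmap mulmx_Deigmap eigvecD mulmxDr.
apply/colP => i; rewrite !mxE; ring.
Qed.

Lemma newton_mapD (x h : Omega) :
  newton_map S (eigmap A k vk) (x + h) =
  newton_map S (eigmap A k vk) x + Dnewton x *m h
  + h ord0 0 *: (S *m eigdir *m h).
Proof.
rewrite /newton_map /Dnewton eigmapD (mulmxBl 1%:M) mul1mx -!mulmxA.
rewrite mulmxBr mulmxDr -scalemxAr.
by apply/colP => i; rewrite !mxE; ring.
Qed.

(** Along a coordinate direction [newton_mapD] is a quadratic polynomial in the step, and its linear
    coefficient is the entry sought. *)
Lemma cjacobian_newton_map (x : Omega) :
  cjacobian (newton_map S (eigmap A k vk)) x = Dnewton x.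
Proof.
apply/matrixP => i j; rewrite mxE.
apply: (@derive_quadratic _ _ _ _ _ _
  (delta_mx j 0 ord0 0 * (S *m eigdir *m (delta_mx j 0 : Omega)) i 0)) => h.
rewrite addrC newton_mapD -!scalemxAr -!colE.
by rewrite !mxE; ring.
Qed.

(* Exact because the Newton map is quadratic; this replaces the mean value
   theorem. *)
Lemma newton_map_midpoint (x y : Omega) :
  newton_map S (eigmap A k vk) y - newton_map S (eigmap A k vk) x =
  Dnewton (2^-1 *: (x + y)) *m (y - x).
Proof.
(* Expanding about the midpoint [m], the quadratic terms at [m + h] and [m - h] agree and cancel in
   the difference. *)
set m := 2^-1 *: (x + y); set h := 2^-1 *: (y - x).
have xE : x = m + - h by apply/colP => i; rewrite !mxE; field.
have yE : y = m + h by apply/colP => i; rewrite !mxE; field.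
have -> : y - x = h + h by apply/colP => i; rewrite !mxE; field.
rewrite xE yE !newton_mapD mulmxDr !mulmxN.
by apply/colP => i; rewrite !mxE; ring.
Qed.

End Eigmap.

(** * Invertibility and the radii polynomial criterion *)

(** A kernel vector of I - M is fixed by M, so its norm is at most q times itself, hence zero. *)
Lemma contraction_unitmx (R : realType) (n : nat) (M : 'M[R[i]]_n.+1) (q : R) :
  q < 1 -> (forall c, cnorm (M *m c) <= q * cnorm c) ->
  1%:M - M \in unitmx.
Proof.
(* [det0P] yields a row vector, so it is applied to the transpose to obtain a kernel column. *)
move=> q1 Mq; rewrite -unitmx_tr unitmxE unitfE; apply/det0P => -[w w0 wM].
have Mw : M *m w^T = w^T.
  apply/esym/eqP; rewrite -subr_eq0 -{1}[w^T]mul1mx -mulmxBl.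
  by rewrite -[1%:M - M]trmxK -trmx_mul wM trmx0.
move/eqP: w0; apply; apply/trmx_inj; rewrite trmx0; apply/cnorm0_eq0.
have := Mq w^T; have := cnorm_ge0 w^T; rewrite Mw.
by move: (cnorm w^T) => a a0 aq; apply/eqP; rewrite eq_le a0 andbT; nra.
Qed.

Theorem lemma2p3 (R : realType) (n : nat) (A : 'M[R[i]]_n.+1)
    (lambda : R[i]) (v : 'cV[R[i]]_n.+1) (k : 'I_n.+1)
    (hk : forall i : 'I_n.+1, cabs (v i 0) <= cabs (v k 0))
    (S : 'M[R[i]]_n.+1) (Y : 'cV[R]_n.+1) (Z : R -> 'cV[R]_n.+1) :
  let f := eigmap A k (v k 0) in
  let xbar := eigpoint k lambda v in
  let T := newton_map S f in
  (forall j : 'I_n.+1, cabs ((T xbar - xbar) j 0) <= Y j 0) ->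
  forall r : R, 0 < r ->
    (forall j : 'I_n.+1, (sup_DT T xbar r j <= (Z r j 0)%:E)%E) ->
    (forall j : 'I_n.+1, radii_poly Y Z j r < 0) ->
    exists! x : 'cV[R[i]]_n.+1, Bball xbar r x /\ f x = 0.
Proof.
move=> f xbar T TY r r0 TZ pr.
pose D := Dnewton A S k (v k 0).
have DZ j (b c : 'cV_n.+1) : cnorm b <= r -> cnorm c <= r ->
    cabs ((D (xbar + b) *m c) j 0) <= Z r j 0.
  move=> br cr; rewrite -lee_fin; apply: le_trans (TZ j).
  apply: ereal_sup_ubound; exists (b, c) => /=.
    by split; apply/BballE; rewrite sub0r cnormN.
  by rewrite cjacobian_newton_map.
have YZ j : Y j 0 + Z r j 0 < r.
  by have := pr j; rewrite /radii_poly mxE subr_lt0.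
have Zr j : Z r j 0 < r.
  (* [Y j 0] bounds a modulus, so it is nonnegative. *)
  apply: le_lt_trans (YZ j).
  by rewrite lerDr (le_trans _ (TY j))// cabs_ge0.
(* The maximum starts from 0, which gives [0 <= q]; having finitely many ratios, each below 1, gives
   [q < 1]. *)
pose q := \big[Num.max/0]_j (Z r j 0 / r).
have q0 : 0 <= q by exact: bigmax_ge_id.
have q1 : q < 1.
  by apply/bigmax_ltP; split=> // j _; rewrite ltr_pdivrMr// mul1r.
have Zq j : Z r j 0 <= q * r.
  by rewrite -ler_pdivrMr//; exact: (le_bigmax _ (fun j => Z r j 0 / r)).
have Dq (b c : 'cV_n.+1) : cnorm b <= r -> cnorm (D (xbar + b) *m c) <= q * cnorm c.
  move=> br; have [c0|c0] := eqVneq (cnorm c) 0.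
    by rewrite (cnorm0_eq0 c0) mulmx0 /cnorm normr0/= mulr0.
  have cgt0 : 0 < cnorm c by rewrite lt_def c0 cnorm_ge0.
  (* [DZ] covers only vectors of norm at most r, so [c] is rescaled to norm r and homogeneity does
     the rest. *)
  pose t := r / cnorm c.
  have t0 : 0 < t by rewrite divr_gt0.
  have tE : cabs t%:C = t.
    by apply: complexI; rewrite -normcE ger0_norm// lecR ltW.
  have tc : cnorm (t%:C *: c) <= r by rewrite cnormZ tE divfK.
  rewrite -(ler_pM2l t0) -{1}tE -cnormZ scalemxAr mulrCA divfK//.
  apply/cnormP => [|j]; first by rewrite mulr_ge0// ltW.
  exact: le_trans (DZ j _ _ br tc) (Zq j).
have Dball x c : cnorm (xbar - x) <= r -> cnorm (D x *m c) <= q * cnorm c.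
  by move=> xr; rewrite -[x](subrKC xbar); apply: Dq; rewrite cnormB.
have Tq x y : cnorm (xbar - x) <= r -> cnorm (xbar - y) <= r ->
    cnorm (T x - T y) <= q * cnorm (x - y).
  move=> xr yr; rewrite newton_map_midpoint; apply: Dball.
  (* The midpoint lies in the ball by convexity. *)
  have -> : xbar - 2^-1 *: (y + x) = 2^-1 *: ((xbar - x) + (xbar - y)).
    by apply/colP => i; rewrite !mxE; field.
  rewrite cnorm_half.
  by have := cnormD (xbar - x) (xbar - y); lra.
have Tball x : cnorm (xbar - x) <= r -> cnorm (xbar - T x) <= r.
  move=> xr; apply/cnormP => [|j]; first exact: ltW.
  (* Y bounds the first summand. The second is [D] at a midpoint applied to [x - xbar], which lies
     in B(r), so Z(r) bounds it. *)
  have -> : xbar - T x = - ((T xbar - xbar) + (T x - T xbar)).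
    by rewrite (addrC (T xbar - xbar)) subrKA [RHS]opprB.
  rewrite mxE cabsN mxE; apply: le_trans (cabsD _ _) (le_trans _ (ltW (YZ j))).
  apply: lerD; first exact: TY.
  rewrite newton_map_midpoint.
  have -> : 2^-1 *: (xbar + x) = xbar + 2^-1 *: (x - xbar).
    by apply/colP => i; rewrite !mxE; field.
  apply: DZ; last by rewrite cnormB.
  rewrite cnorm_half cnormB.
  by have := cnorm_ge0 (xbar - x); lra.
(* If S were singular, S *m Deigmap would have a kernel, whose nonzero vectors
   the contraction D xbar would fix. *)
have Sunit : S \in unitmx.
  have : 1%:M - D xbar \in unitmx.
    apply: (contraction_unitmx q1) => c; apply: Dball.
    by rewrite subrr /cnorm normr0 ltW.
  by rewrite /D /Dnewton opprB addrC subrK unitmx_mul => /andP[].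
have fixE x : f x = 0 <-> T x = x.
  rewrite /T /newton_map; split=> [->|/eqP]; first by rewrite mulmx0 subr0.
  rewrite -subr_eq0 addrAC subrr sub0r oppr_eq0 => /eqP Sf.
  by rewrite -[f x](mulKmx Sunit) Sf mulmx0.
have [x [xr Tx]] := banach_fixed_point_cV q0 q1 (ltW r0) Tball Tq.
exists x; split; first by split; [exact/BballE | exact/fixE].
move=> y [/BballE yr /fixE Ty]; apply/eqP; rewrite -subr_eq0; apply/eqP.
apply: cnorm0_eq0; have := Tq _ _ xr yr; rewrite Tx Ty.
have := cnorm_ge0 (x - y); move: (cnorm _) => a a0 aq.
by apply/eqP; rewrite eq_le a0 andbT; nra.
Qed.
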